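(* Let $(\mathfrak{L},\{\cdot,\cdot,\cdot\})$ be a Leibniz triple system, $(r,m,l)$ a representation of $\mathfrak{L}$ on a vector space $V$, and let $T_1,T_2:V\to\mathfrak{L}$ be two compatible relative Rota-Baxter operators on $\mathfrak{L}$ with respect to $(r,m,l)$. If $T_2$ (resp. $T_1$) is invertible, then $N=T_1T_2^{-1}$ (resp. $N=T_2T_1^{-1}$) is a Nijenhuis operator on $(\mathfrak{L},\{\cdot,\cdot,\cdot\})$.
   Context: All vector spaces are over a fixed arbitrary field $\mathbb{F}$. A Leibniz triple system is a vector space $\mathfrak{L}$ with a trilinear operation $\{\cdot,\cdot,\cdot\}:\mathfrak{L}\times\mathfrak{L}\times\mathfrak{L}\to\mathfrak{L}$ such that for all $a,b,c,d,e\in\mathfrak{L}$: $\{a,b,\{c,d,e\}\}=\{\{a,b,c\},d,e\}-\{\{a,b,d\},c,e\}-\{\{a,b,e\},c,d\}+\{\{a,b,e\},d,c\}$ and $\{a,\{b,c,d\},e\}=\{\{a,b,c\},d,e\}-\{\{a,c,b\},d,e\}-\{\{a,d,b\},c,e\}+\{\{a,d,c\},b,e\}$. A representation of $\mathfrak{L}$ on a vector space $V$ is a triple $(r,m,l)$ of bilinear maps $l,m,r:\mathfrak{L}\times\mathfrak{L}\to\mathrm{End}(V)$ such that for all $a,b,c,d\in\mathfrak{L}$: $l(a,\{b,c,d\})=l(\{a,b,c\},d)-l(\{a,c,b\},d)-l(\{a,d,b\},c)+l(\{a,d,c\},b)$; $m(a,d)l(b,c)=m(\{a,b,c\},d)-m(\{a,c,b\},d)-r(c,d)m(a,b)+r(b,d)m(a,c)$;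 $m(a,d)m(b,c)=r(c,d)l(a,b)-r(c,d)m(a,b)-m(\{a,c,b\},d)+r(b,d)l(a,c)$; $m(a,d)r(b,c)=r(c,d)m(a,b)-r(c,d)l(a,b)-r(b,d)l(a,c)+m(\{a,c,b\},d)$; $r(\{a,b,c\},d)=r(c,d)r(a,b)-r(c,d)r(b,a)-r(b,d)r(c,a)+r(a,d)r(c,b)$; $l(a,b)l(c,d)=l(\{a,b,c\},d)-l(\{a,b,d\},c)-r(c,d)l(a,b)+r(d,c)l(a,b)$; $l(a,b)m(c,d)=m(\{a,b,c\},d)-r(c,d)l(a,b)-l(\{a,b,d\},c)+m(\{a,b,d\},c)$; $l(a,b)r(c,d)=r(c,d)l(a,b)-m(\{a,b,c\},d)-m(\{a,b,d\},c)+l(\{a,b,d\},c)$; $m(a,\{b,c,d\})=r(c,d)m(a,b)-r(b,d)m(a,c)-r(b,c)m(a,d)+r(c,b)m(a,d)$; $r(a,\{b,c,d\})=r(c,d)r(a,b)-r(b,d)r(a,c)-r(b,c)r(a,d)+r(c,b)r(a,d)$. A relative Rota-Baxter operator on $(\mathfrak{L},\{\cdot,\cdot,\cdot\})$ with respect to $(r,m,l)$ is a linear map $T:V\to\mathfrak{L}$ with $\{Tu,Tv,Tw\}=T\big(l(Tu,Tv)w+m(Tu,Tw)v+r(Tv,Tw)u\big)$ for all $u,v,w\in V$. Two relative Rota-Baxter operators $T_1,T_2:V\to\mathfrak{L}$ are compatible if for all $\lambda,\eta\in\mathbb{F}$ the map $\lambda T_1+\eta T_2:V\to\mathfrak{L}$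 is a relative Rota-Baxter operator. A Nijenhuis operator on $(\mathfrak{L},\{\cdot,\cdot,\cdot\})$ is a linear map $N:\mathfrak{L}\to\mathfrak{L}$ such that for all $x,y,z\in\mathfrak{L}$: $\{Nx,Ny,Nz\}=N\{Nx,Ny,z\}+N\{x,Ny,Nz\}+N\{Nx,y,Nz\}-N^2\{Nx,y,z\}-N^2\{x,Ny,z\}-N^2\{x,y,Nz\}+N^3\{x,y,z\}$.
   Formalization: The field is assumed to have more than two elements; over the two-element field, compatibility as defined (all λ, η in the field) does not imply the Nijenhuis identity and the statement is false. *)

(* Defs.v *)
From HB Require Import structures.
From mathcomp Require Import all_boot all_order all_algebra.

Set Implicit Arguments.
Unset Strict Implicit.
Unset Printing Implicit Defensive.

Import GRing.Theory.
Local Open Scope ring_scope.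

(* Vector spaces are arbitrary (possibly infinite-dimensional) [lmodType]s,
   and End(V) is the type [{linear V -> V}]. *)

Record leibniz_triple_system (F : fieldType) (L : lmodType F)
    (br : L -> L -> L -> L) : Prop := LeibnizTripleSystem {
  lts_linear1 : forall b c, linear (fun a => br a b c);
  lts_linear2 : forall a c, linear (fun b => br a b c);
  lts_linear3 : forall a b, linear (fun c => br a b c);
  lts_right : forall a b c d e,
    br a b (br c d e) =
      br (br a b c) d e - br (br a b d) c e
      - br (br a b e) c d + br (br a b e) d c;
  lts_middle : forall a b c d e,
    br a (br b c d) e =
      br (br a b c) d e - br (br a c b) d e
      - br (br a d b) c e + br (br a d c) b e }.

(* [{linear V -> V}] carries no vector space structure in the library, so
   bilinearity of a map L x L -> End(V) is stated pointwise on V. *)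
Definition bilinear_End (F : fieldType) (L V : lmodType F)
    (f : L -> L -> {linear V -> V}) : Prop :=
  forall v : V, bilinear_for *:%R *:%R (fun a b => f a b v).

(* Identities in End(V) are stated pointwise on V; juxtaposition of
   endomorphisms is composition. *)
Record lts_representation (F : fieldType) (L : lmodType F)
    (br : L -> L -> L -> L) (V : lmodType F)
    (r m l : L -> L -> {linear V -> V}) : Prop := LtsRepresentation {
  rep_l_bilinear : bilinear_End l;
  rep_m_bilinear : bilinear_End m;
  rep_r_bilinear : bilinear_End r;
  rep_l_br2 : forall a b c d v,
    l a (br b c d) v =
      l (br a b c) d v - l (br a c b) d v
      - l (br a d b) c v + l (br a d c) b v;
  rep_m_l : forall a b c d v,
    m a d (l b c v) =
      m (br a b c) d v - m (br a c b) d v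
      - r c d (m a b v) + r b d (m a c v);
  rep_m_m : forall a b c d v,
    m a d (m b c v) =
      r c d (l a b v) - r c d (m a b v)
      - m (br a c b) d v + r b d (l a c v);
  rep_m_r : forall a b c d v,
    m a d (r b c v) =
      r c d (m a b v) - r c d (l a b v)
      - r b d (l a c v) + m (br a c b) d v;
  rep_r_br1 : forall a b c d v,
    r (br a b c) d v =
      r c d (r a b v) - r c d (r b a v)
      - r b d (r c a v) + r a d (r c b v);
  rep_l_l : forall a b c d v,
    l a b (l c d v) =
      l (br a b c) d v - l (br a b d) c v
      - r c d (l a b v) + r d c (l a b v);
  rep_l_m : forall a b c d v,
    l a b (m c d v) =
      m (br a b c) d v - r c d (l a b v)
      - l (br a b d) c v + m (br a b d) c v;
  rep_l_r : forall a b c d v,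
    l a b (r c d v) =
      r c d (l a b v) - m (br a b c) d v
      - m (br a b d) c v + l (br a b d) c v;
  rep_m_br2 : forall a b c d v,
    m a (br b c d) v =
      r c d (m a b v) - r b d (m a c v)
      - r b c (m a d v) + r c b (m a d v);
  rep_r_br2 : forall a b c d v,
    r a (br b c d) v =
      r c d (r a b v) - r b d (r a c v)
      - r b c (r a d v) + r c b (r a d v) }.

Record relative_Rota_Baxter (F : fieldType) (L : lmodType F)
    (br : L -> L -> L -> L) (V : lmodType F)
    (r m l : L -> L -> {linear V -> V}) (T : V -> L) : Prop :=
  RelativeRotaBaxter {
  rRB_linear : linear T;
  rRB_br : forall u v w,
    br (T u) (T v) (T w) =
      T (l (T u) (T v) w + m (T u) (T w) v + r (T v) (T w) u) }.

Record compatible_rRB (F : fieldType) (L : lmodType F)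
    (br : L -> L -> L -> L) (V : lmodType F)
    (r m l : L -> L -> {linear V -> V}) (T1 T2 : V -> L) : Prop :=
  CompatibleRRB {
  compat_rRB1 : relative_Rota_Baxter br r m l T1;
  compat_rRB2 : relative_Rota_Baxter br r m l T2;
  compat_comb : forall lam eta : F,
    relative_Rota_Baxter br r m l (fun u => lam *: T1 u + eta *: T2 u) }.

Record Nijenhuis (F : fieldType) (L : lmodType F)
    (br : L -> L -> L -> L) (N : L -> L) : Prop := NijenhuisOperator {
  Nij_linear : linear N;
  Nij_br : forall x y z,
    br (N x) (N y) (N z) =
      N (br (N x) (N y) z) + N (br x (N y) (N z)) + N (br (N x) y (N z))
      - N (N (br (N x) y z)) - N (N (br x (N y) z)) - N (N (br x y (N z)))
      + N (N (N (br x y z))) }.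

(* Main.v *)
Require Import Defs.
From HB Require Import structures.
From mathcomp Require Import all_boot all_order all_algebra.

Set Implicit Arguments.
Unset Strict Implicit.

Import GRing.Theory.
Local Open Scope ring_scope.

(** Write the Rota-Baxter identity of an operator [T] as
    [{Tu,Tv,Tw} = T (K T T)], where [K P Q] denotes
    [l(Pu,Qv)w + m(Pu,Qw)v + r(Pv,Qw)u], a form that is bilinear in the pair
    of operators [(P, Q)]. For [T = c T1 + T2] both sides are polynomials of
    degree 3 in [c]; they agree for every [c], and their extreme coefficients
    agree because [T1] and [T2] are themselves Rota-Baxter. The two middle
    coefficients remain, and the values [c = 1] and [c <> 0, 1] suffice to
    separate them (lemma [separate_mixed_terms]). With
    [S = K T1 T2 + K T2 T1] this gives (lemma [compatible_mixed_br])

      [{T1u,T1v,T2w} + {T1u,T2v,T1w} + {T2u,T1v,T1w} = T1 S + T2 (K T1 T1)],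
      [{T1u,T2v,T2w} + {T2u,T1v,T2w} + {T2u,T2v,T1w} = T1 (K T2 T2) + T2 S].

    Now put [x = T2 u], [y = T2 v], [z = T2 w] and let [N] be the linear map
    with [N T2 = T1]. Applying [N] to the first identity, and [N^2] to the
    second, the terms [N T1 S] cancel in the difference. What is left is
    [T1 (K T1 T1) - N^2 T1 (K T2 T2)], that is
    [{Nx,Ny,Nz} - N^3 {x,y,z}], which is the Nijenhuis identity. Compatibility
    is symmetric in [T1] and [T2], so the second half of the result follows
    from the first. *)

(** * Expansion of multilinear maps on affine lines *)

(** Polynomials in [c] with vector coefficients are kept in Horner form, so
    that adding two of them only takes distributivity. *)
Lemma horner2_add (R : nzRingType) (M : lmodType R) (c : R)
    (a2 a1 a0 b2 b1 b0 : M) :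
  (c *: (c *: a2 + a1) + a0) + (c *: (c *: b2 + b1) + b0) =
    c *: (c *: (a2 + b2) + (a1 + b1)) + (a0 + b0).
Proof. by rewrite addrACA -scalerDr addrACA -scalerDr. Qed.

Lemma bilinear_line (R : nzRingType) (X Y M : lmodType R) (f : X -> Y -> M)
    (f_lin1 : forall y, linear (f^~ y)) (f_lin2 : forall x, linear (f x))
    (c : R) (x x' : X) (y y' : Y) :
  f (c *: x + x') (c *: y + y') =
    c *: (c *: f x y + (f x y' + f x' y)) + f x' y'.
Proof. by rewrite (f_lin1 _ c x x') !f_lin2 !scalerDr !addrA. Qed.

Lemma trilinear_line (R : nzRingType) (X M : lmodType R) (f : X -> X -> X -> M)
    (f_lin1 : forall y z, linear (fun x => f x y z))
    (f_lin2 : forall x z, linear (fun y => f x y z))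
    (f_lin3 : forall x y, linear (f x y))
    (c : R) (x x' y y' z z' : X) :
  f (c *: x + x') (c *: y + y') (c *: z + z') =
    c *: (c *: (c *: f x y z + (f x y z' + f x y' z + f x' y z))
          + (f x y' z' + f x' y z' + f x' y' z)) + f x' y' z'.
Proof.
rewrite (f_lin1 _ _ c x x') !(bilinear_line (f := f _)) //.
by rewrite addrA -scalerDr addrACA -scalerDr -!addrA.
Qed.

(** The value at [c = 1] fixes the sum of the two coefficients, so the value
    at any other nonzero [c] determines the first of them. *)
Lemma separate_mixed_terms (F : fieldType) (M : lmodType F)
    (a3 a2 a1 a0 b2 b1 : M) :
  (exists c : F, c != 0 /\ c != 1) ->
  (forall c : F, c *: (c *: (c *: a3 + a2) + a1) + a0 =
                 c *: (c *: (c *: a3 + b2) + b1) + a0) ->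
  a2 = b2 /\ a1 = b1.
Proof.
move=> [c [c_neq0 c_neq1]] eq_ab.
have lineE k : k != 0 -> k *: a2 + a1 = k *: b2 + b1.
  move=> k_neq0; have /addIr/(scalerI k_neq0) := eq_ab k.
  by rewrite !scalerDr -!addrA => /addrI.
have eq1 := lineE 1 (oner_neq0 F); rewrite !scale1r in eq1.
have eq2 : a2 = b2.
  apply: (@scalerI _ _ (c - 1)); first by rewrite subr_eq0.
  apply: (@addIr _ (a2 + a1)); rewrite {2}eq1 !addrA !scalerBl !scale1r !subrK.
  exact: lineE.
by split=> //; move: eq1; rewrite eq2 => /addrI.
Qed.

(** * Compatible relative Rota-Baxter operators *)

(** The argument of [T] on the right-hand side of the Rota-Baxter identity,
    polarized: the two occurrences of [T] inside it become [P] and [Q]. *)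
Definition rRB_form (F : fieldType) (L V : lmodType F)
    (r m l : L -> L -> {linear V -> V}) (P Q : V -> L) (u v w : V) : V :=
  l (P u) (Q v) w + m (P u) (Q w) v + r (P v) (Q w) u.

Lemma rRB_form_line (F : fieldType) (L V : lmodType F)
    (r m l : L -> L -> {linear V -> V})
    (l_bil : bilinear_End l) (m_bil : bilinear_End m) (r_bil : bilinear_End r)
    (c : F) (P Q : V -> L) (u v w : V) :
  let K P' Q' := rRB_form r m l P' Q' u v w in
  let T x := c *: P x + Q x in
  K T T = c *: (c *: K P P + (K P Q + K Q P)) + K Q Q.
Proof.
have line (f : L -> L -> {linear V -> V}) : bilinear_End f -> forall a a' b b' t,
    f (c *: a + a') (c *: b + b') t =
      c *: (c *: f a b t + (f a b' t + f a' b t)) + f a' b' t.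
  move=> f_bil a a' b b' t; have [f1 f2] := f_bil t.
  exact: (bilinear_line (f := fun x y => f x y t)).
rewrite /rRB_form /= !line // !horner2_add.
by congr (c *: (_ + _) + _); rewrite [X in X + _ = _]addrACA [LHS]addrACA.
Qed.

Lemma compatible_rRB_sym (F : fieldType) (L V : lmodType F)
    (br : L -> L -> L -> L) (r m l : L -> L -> {linear V -> V})
    (T1 T2 : V -> L) :
  compatible_rRB br r m l T1 T2 -> compatible_rRB br r m l T2 T1.
Proof.
case=> rRB1 rRB2 comb; split=> // lam eta.
have [lin rRB] := comb eta lam.
split=> [c u v | u v w]; first by have := lin c u v; rewrite ![eta *: _ + _]addrC.
by have := rRB u v w; rewrite ![eta *: _ + _]addrC.
Qed.

(** Comparison of the coefficients of [c^2] and [c] in the Rota-Baxter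
    identity of [c T1 + T2]. *)
Lemma compatible_mixed_br (F : fieldType)
    (F_not_F2 : exists c : F, c != 0 /\ c != 1)
    (L V : lmodType F) (br : L -> L -> L -> L)
    (br1 : forall b c, linear (fun a => br a b c))
    (br2 : forall a c, linear (fun b => br a b c))
    (br3 : forall a b, linear (br a b))
    (r m l : L -> L -> {linear V -> V})
    (l_bil : bilinear_End l) (m_bil : bilinear_End m) (r_bil : bilinear_End r)
    (T1 T2 : V -> L) (T12_compat : compatible_rRB br r m l T1 T2)
    (u v w : V) :
  let K P Q := rRB_form r m l P Q u v w in
  let S := K T1 T2 + K T2 T1 in
  br (T1 u) (T1 v) (T2 w) + br (T1 u) (T2 v) (T1 w) + br (T2 u) (T1 v) (T1 w)
    = T1 S + T2 (K T1 T1) /\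
  br (T1 u) (T2 v) (T2 w) + br (T2 u) (T1 v) (T2 w) + br (T2 u) (T2 v) (T1 w)
    = T1 (K T2 T2) + T2 S.
Proof.
move=> K S; have [[lin1 rRB1] [lin2 rRB2] comb] := T12_compat.
apply: (separate_mixed_terms (a3 := br (T1 u) (T1 v) (T1 w))
  (a0 := br (T2 u) (T2 v) (T2 w)) F_not_F2) => c.
rewrite -(trilinear_line (f := br)) //.
have [_ rRB] := comb c 1; have := rRB u v w; rewrite !scale1r => ->.
have := rRB_form_line l_bil m_bil r_bil c T1 T2 u v w.
rewrite /= {1}/rRB_form -/K -/S => ->.
rewrite !lin1 !lin2 rRB1 rRB2 -/(rRB_form r m l T1 T1 u v w) -/(K T1 T1).
rewrite -/(rRB_form r m l T2 T2 u v w) -/(K T2 T2).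
by rewrite addrA -scalerDr addrACA -scalerDr -[_ + T1 S + _]addrA.
Qed.

(** * The Nijenhuis operator *)

Lemma compatible_rRB_Nijenhuis (F : fieldType)
    (F_not_F2 : exists c : F, c != 0 /\ c != 1)
    (L V : lmodType F) (br : L -> L -> L -> L)
    (br1 : forall b c, linear (fun a => br a b c))
    (br2 : forall a c, linear (fun b => br a b c))
    (br3 : forall a b, linear (br a b))
    (r m l : L -> L -> {linear V -> V})
    (l_bil : bilinear_End l) (m_bil : bilinear_End m) (r_bil : bilinear_End r)
    (T1 T2 : V -> L) (T12_compat : compatible_rRB br r m l T1 T2)
    (T2inv : L -> V) (T2K : cancel T2 T2inv) (T2invK : cancel T2inv T2) :
  Nijenhuis br (T1 \o T2inv).
Proof.
have [[lin1 rRB1] [lin2 rRB2] _] := T12_compat.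
set N := T1 \o T2inv.
have N_lin : linear N.
  move=> c x y; rewrite /N /= -lin1; congr T1; apply: (can_inj T2K).
  by rewrite T2invK lin2 !T2invK.
have ND x y : N (x + y) = N x + N y by have := N_lin 1 x y; rewrite !scale1r.
have NT2 u : N (T2 u) = T1 u by rewrite /N /= T2K.
split=> // x y z.
rewrite -[x]T2invK -[y]T2invK -[z]T2invK !NT2.
move: (T2inv x) (T2inv y) (T2inv z) => u v w {x y z}.
have [] := compatible_mixed_br F_not_F2 br1 br2 br3 l_bil m_bil r_bil
  T12_compat u v w.
set K11 := rRB_form r m l T1 T1 u v w.
set K22 := rRB_form r m l T2 T2 u v w.
set S := rRB_form r m l T1 T2 u v w + _.
move=> /(congr1 N); rewrite !ND NT2 => mixed1.
move=> /(congr1 (N \o N)) /=; rewrite !ND !NT2 => mixed2.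
have -> : br (T1 u) (T1 v) (T1 w) = T1 K11 by exact: rRB1.
have -> : br (T2 u) (T2 v) (T2 w) = T2 K22 by exact: rRB2.
rewrite NT2 [X in X - _ - _ - _]addrAC mixed1.
transitivity (N (T1 S) + T1 K11 - (N (N (T1 K22)) + N (T1 S)) + N (N (T1 K22))).
  by rewrite [N (N _) + _]addrC opprD addrA subrK [RHS]addrC addKr.
by rewrite -mixed2 !opprD !addrA.
Qed.

Unset Implicit Arguments.
Set Strict Implicit.

(* The hypothesis on F says that F is not the field with two elements; over
   that field the four combinations lam T1 + eta T2 do not separate the two
   mixed terms, and the claim fails. *)
Theorem proposition3p10 (F : fieldType)
    (F_not_F2 : exists c : F, c != 0 /\ c != 1)
    (L : lmodType F) (br : L -> L -> L -> L)
    (br_lts : leibniz_triple_system br)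
    (V : lmodType F) (r m l : L -> L -> {linear V -> V})
    (rml_rep : lts_representation br r m l)
    (T1 T2 : V -> L)
    (T12_compat : compatible_rRB br r m l T1 T2) :
  (forall T2inv : L -> V, cancel T2 T2inv -> cancel T2inv T2 ->
     Nijenhuis br (T1 \o T2inv)) /\
  (forall T1inv : L -> V, cancel T1 T1inv -> cancel T1inv T1 ->
     Nijenhuis br (T2 \o T1inv)).
Proof.
have [br1 br2 br3 _ _] := br_lts.
have l_bil := rep_l_bilinear rml_rep.
have m_bil := rep_m_bilinear rml_rep.
have r_bil := rep_r_bilinear rml_rep.
split=> Tinv TK TinvK.
  exact: (compatible_rRB_Nijenhuis F_not_F2 br1 br2 br3 l_bil m_bil r_bil
            T12_compat TK TinvK).
have T21_compat := compatible_rRB_sym T12_compat.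
exact: (compatible_rRB_Nijenhuis F_not_F2 br1 br2 br3 l_bil m_bil r_bil
          T21_compat TK TinvK).
Qed.
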